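(* Let $K$ be a totally real number field of degree $d\ge3$ over $\mathbb{Q}$ and $\Lambda$ a lattice in $K$. Then the unimodular lattice $x_\Lambda\in X_d$ is GFL: for every $v\in\mathbb{R}^d$ there is a nonzero integer $n$ with $N(x_\Lambda+nv)=0$.
   Context: A lattice in $K$ is the $\mathbb{Z}$-span of a $\mathbb{Q}$-basis of $K$. With $\sigma_1,\dots,\sigma_d$ the real embeddings of $K$ and $\varphi=(\sigma_1,\dots,\sigma_d):K\to\mathbb{R}^d$, $x_\Lambda=c\varphi(\Lambda)$ where $c>0$ normalizes the covolume to one. $X_d$ is the space of unimodular lattices in $\mathbb{R}^d$. For $w\in\mathbb{R}^d$, $N(w)=\prod_iw_i$, and for a grid $y$ (translate of a lattice), $N(y)=\inf\{|N(w)|:w\in y\}$. A grid $y$ is FL if $N(ny)=0$ for some nonzero integer $n$, where $n(x+v)=x+nv$; a lattice $x$ is GFL if every grid $x+v$ is FL. *)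

(* Defs.v *)
From HB Require Import structures.
From mathcomp Require Import all_boot all_order all_algebra all_field.
From mathcomp Require Import boolp classical_sets reals.
Set Implicit Arguments. Unset Strict Implicit. Unset Printing Implicit Defensive.
Import Order.TTheory GRing.Theory Num.Theory.
Local Open Scope ring_scope.
Local Open Scope classical_set_scope.

Section Defs.
Variable R : realType.
Variable d : nat.

Definition normN (w : 'rV[R]_d) : R := \prod_(i < d) w ord0 i.

Definition grid (x : set 'rV[R]_d) (v : 'rV[R]_d) : set 'rV[R]_d :=
  [set w + v | w in x].

Definition gridN (y : set 'rV[R]_d) : R := inf [set `|normN w| | w in y].

Definition FL (x : set 'rV[R]_d) (v : 'rV[R]_d) : Prop :=
  exists n : int, n != 0 /\ gridN (grid x (v *~ n)) = 0.

Definition GFL (x : set 'rV[R]_d) : Prop := forall v : 'rV[R]_d, FL x v.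

Variable K : fieldExtType rat.

Definition zspan (b : d.-tuple K) : set K :=
  [set x | exists z : 'I_d -> int, x = \sum_(j < d) tnth b j *~ z j].

Definition phi (sigma : 'I_d -> {rmorphism K -> R}) (x : K) : 'rV[R]_d :=
  \row_(i < d) sigma i x.

(* the matrix (sigma_i(b_j)); |det| is the covolume of phi(Lambda) *)
Definition embmx (sigma : 'I_d -> {rmorphism K -> R}) (b : d.-tuple K) : 'M[R]_d :=
  \matrix_(i < d, j < d) sigma i (tnth b j).

Definition xLambda (sigma : 'I_d -> {rmorphism K -> R}) (b : d.-tuple K) (c : R)
  : set 'rV[R]_d := [set c *: phi sigma x | x in zspan b].

End Defs.

(* Main.v *)
(* Write L for the lattice and U for the group of units u with u L = L, acting on
   R^d through the embeddings. The norm is U-invariant up to sign, so it is enough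
   to find in the closure of U v + L a torsion point p: if n p is in L, then U (n v)
   comes arbitrarily close to L.
   For each place i there is a unit that is > 1 at i and < 1 at the other places
   (Dirichlet). As d >= 3, the values of U at i are dense among the positive reals.
   Hence a closed set invariant under L, -1 and a finite index subgroup of U, and
   in which 0 is not isolated, is R^d. Suppose now that a closed invariant set F has no
   torsion point and let M in F be minimal for the units congruent to 1 modulo n.
   Then 0 is not isolated in M - M, so M - M = R^d, so M meets its translates by
   L/n and by minimality is equal to them. Letting n grow, F is dense and contains
   the torsion point 0. *)

Require Import Defs.
From HB Require Import structures.
From mathcomp Require Import all_boot all_order all_algebra all_field.
From mathcomp Require Import boolp classical_sets reals.
From mathcomp Require Import topology normedtype.
From mathcomp Require Import zify ring lra.
Import Order.TTheory GRing.Theory Num.Theory numFieldNormedType.Exports.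
Local Open Scope ring_scope.
Local Open Scope classical_set_scope.
Set Implicit Arguments. Unset Strict Implicit. Unset Printing Implicit Defensive.

(** * Uniformity and pigeonhole over finite types *)

Lemma finite_common_bound (I : finType) (P : I -> nat -> Prop) :
  (forall i, exists n, forall m, (n <= m)%N -> P i m) ->
  exists n, forall i, P i n.
Proof.
move=> /choice [f fP]; exists (\max_i f i) => i.
by apply: fP; apply: leq_bigmax.
Qed.

Lemma finite_common_multiple (I : finType) (P : I -> nat -> Prop) :
  (forall i, exists2 n, (0 < n)%N & forall m, (n %| m)%N -> P i m) ->
  exists2 n, (0 < n)%N & forall i, P i n.
Proof.
move=> h; have /choice [f fP] : forall i, exists n, (0 < n)%N /\ forall m, (n %| m)%N -> P i m.
  by move=> i; have [n n0 nP] := h i; exists n.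
exists (\prod_i f i)%N; first by rewrite prodn_cond_gt0 // => i _; apply: (fP i).1.
by move=> i; apply: (fP i).2; rewrite (bigD1 i) //= dvdn_mulr.
Qed.

(** Otherwise each value dies out beyond some index, and at a common such index [f] could take no
    value. *)
Lemma frequent_value (T : finType) (f : nat -> T) :
  exists c, forall n, exists2 m, (n <= m)%N & f m = c.
Proof.
apply: contrapT => /forallNP h.
have [n /(_ (f n))] : exists n, forall c, f n <> c; last by [].
apply: finite_common_bound => c; have /existsNP [n nP] := h c.
by exists n => m nm fmc; apply: nP; exists m.
Qed.

Lemma exists_notin_seq (T : finType) (s : seq T) :
  (size s < #|T|)%N -> exists x, x \notin s.
Proof.
move=> sT; apply/existsP; apply: contraLR sT; rewrite negb_exists -leqNgt => /forallP h.
apply: leq_trans (card_size s); apply/subset_leq_card/fintype.subsetP => x _.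
by rewrite -[_ \in _]negbK.
Qed.

(** * Powers of a real number and the box principle *)

Section Real.
Variable R : realType.
Implicit Types (x y a e : R).

Lemma expr_unbounded a x : 1 < a -> exists n, x < a ^+ n.
Proof.
move=> a1; have a10 : 0 < a - 1 by rewrite subr_gt0.
have bern n : 1 + n%:R * (a - 1) <= a ^+ n.
  elim: n => [|n IH]; first by rewrite mul0r addr0.
  rewrite exprS -natr1; apply: le_trans (_ : a * (1 + n%:R * (a - 1)) <= _); last first.
    by rewrite ler_pM2l //; lra.
  have : 0 <= n%:R * (a - 1) * (a - 1) by rewrite !mulr_ge0 ?ler0n // ltW.
  nra.
exists (Num.bound `|x / (a - 1)|); apply: lt_le_trans (bern _).
have := le_lt_trans (ler_norm _) (archi_boundP (normr_ge0 (x / (a - 1)))).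
rewrite ltr_pdivrMr // => h.
by apply: lt_le_trans h _; rewrite lerDr.
Qed.

Lemma expr_vanishing a x e : 0 <= a -> a < 1 -> 0 < e ->
  exists n, forall m, (n <= m)%N -> a ^+ m * x < e.
Proof.
move=> a0 a1 e0; have [->|an0] := eqVneq a 0.
  by exists 1%N => -[//|m] _; rewrite exprS !mul0r.
have {an0} a0 : 0 < a by rewrite lt_def an0.
have [n nP] : exists n, `|x| / e < a^-1 ^+ n by apply: expr_unbounded; rewrite invf_gt1.
exists n => m nm; apply: le_lt_trans (_ : a ^+ n * `|x| < e).
  apply: le_trans (_ : a ^+ m * `|x| <= _).
    by rewrite ler_wpM2l ?ler_norm // exprn_ge0 // ltW.
  by rewrite ler_wpM2r // ler_wiXn2l // ltW.
by move: nP; rewrite exprVn ltr_pdivrMr // ltr_pdivlMl ?exprn_gt0.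
Qed.

Lemma expr_floor a x y : 1 < a -> 0 < x -> x <= y ->
  exists n, x * a ^+ n <= y < x * a ^+ n.+1.
Proof.
move=> a1 x0 xy.
have ex : exists n, y < x * a ^+ n.
  by have [n] := expr_unbounded (y / x) a1; rewrite ltr_pdivrMr // mulrC; exists n.
case: (ex_minnP ex) => -[|n]; first by rewrite mulr1 ltNge xy.
move=> yn min; exists n; rewrite yn andbT leNgt; apply/negP => /min.
by rewrite ltnn.
Qed.

(** The cube is cut into [N ^ #|I|] boxes of side [2 * B / N], so two of the points share a box. *)
Lemma pigeonhole_cube (T I : finType) (N : nat) (B : R) (f : T -> I -> R) :
  (0 < N)%N -> (forall (z : T) i, `|f z i| < B) -> (N ^ #|I| < #|T|)%N ->
  exists z w : T, z != w /\ forall i, `|f z i - f w i| < 2 * B / N%:R.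
Proof.
case: N => [//|N] _ fB card_lt.
pose y (z : T) i := (f z i + B) * N.+1%:R / (2 * B).
have y_itv (z : T) i : 0 <= y z i < N.+1%:R.
  have := fB z i; rewrite ltr_norml => /andP[l u]; have B0 : 0 < B by lra.
  rewrite /y divr_ge0 ?mulr_ge0 ?ler0n //=; [|lra..].
  by rewrite ltr_pdivrMr; [rewrite mulrC ltr_pM2l ?ltr0n //; lra|lra].
pose c (z : T) : {ffun I -> 'I_N.+1} := [ffun i => inord (Num.trunc (y z i))].
have /injectivePn[x [x' xx' cxx']] : ~~ injectiveb c.
  by apply/negP => /injectiveP /leq_card; rewrite card_ffun card_ord leqNgt card_lt.
exists x, x'; split => // i.
have cE z : (c z i : nat) = Num.trunc (y z i).
  have /andP[h1 h2] := y_itv z i.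
  by rewrite ffunE inordK // truncn_lt_nat.
have : (c x i : nat) = c x' i by rewrite cxx'.
rewrite !cE.
have /andP[/truncn_itv + _] := y_itv x i; have /andP[/truncn_itv + _] := y_itv x' i.
set t := Num.trunc (y x i); set t' := Num.trunc (y x' i).
move=> /andP[a1 a2] /andP[b1 b2] tt'; rewrite tt' in b1 b2.
have B0 : 0 < B by apply: le_lt_trans (fB x i).
have N0 : 0 < N.+1%:R :> R by rewrite ltr0n.
have -> : f x i - f x' i = (y x i - y x' i) * (2 * B / N.+1%:R).
  by rewrite /y; field; rewrite -natr1 addrC in N0; rewrite !lt0r_neq0.
have q0 : 0 < 2 * B / N.+1%:R by rewrite divr_gt0 //; lra.
rewrite normrM (gtr0_norm q0) gtr_pMl // ltr_norml.
by rewrite -natr1 in a2 b2; apply/andP; split; lra.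
Qed.

(** * Compactness in R^d with the sup norm *)

Section Row.
Variable d : nat.
Implicit Types (w p q : 'rV[R]_d) (A F : set 'rV[R]_d).

Lemma coord_le_norm w i : `|w 0 i| <= `|w|.
Proof.
rewrite [leRHS]/Num.Def.normr /= mx_normrE; apply/bigmax_geP; right => /=.
by exists (ord0, i).
Qed.

Lemma row_norm_le w e : 0 <= e -> (forall i, `|w 0 i| <= e) -> `|w| <= e.
Proof.
move=> e0 we; rewrite [leLHS]/Num.Def.normr /= mx_normrE; apply/bigmax_leP; split => //=.
by move=> [i j] _; rewrite ord1.
Qed.

Lemma row_norm_lt w e : 0 < e -> (forall i, `|w 0 i| < e) -> `|w| < e.
Proof.
move=> e0 we; rewrite [ltLHS]/Num.Def.normr /= mx_normrE; apply/bigmax_ltP; split => //=.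
by move=> [i j] _; rewrite ord1.
Qed.

Lemma bounded_seq_close_pair (s : nat -> 'rV[R]_d) B e :
  (forall k, `|s k| < B) -> 0 < e -> exists k l, (k < l)%N /\ `|s k - s l| < e.
Proof.
move=> xB e0; pose N := (Num.bound (2 * B / e)).+1.
have B0 : 0 < B by apply: le_lt_trans (xB 0)%N.
have [||k [l [kl klP]]] := @pigeonhole_cube 'I_(N ^ d).+1 'I_d N B
  (fun k i => s k 0 i) isT.
- by move=> k i; apply: le_lt_trans (coord_le_norm _ _) (xB k).
- by rewrite !card_ord.
have lt_e : `|s k - s l| < e.
  apply: row_norm_lt => // i; rewrite !mxE; apply: lt_le_trans (klP i) _.
  rewrite ler_pdivrMr ?ltr0n // [e * _]mulrC -ler_pdivrMr //.
  have r0 : 0 <= 2 * B / e by rewrite divr_ge0 ?mulr_ge0 // ltW.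
  by apply: le_trans (ltW (archi_boundP r0)) _; rewrite ler_nat.
have [kl'|lk|/val_inj klE] := ltngtP k l; last by rewrite klE eqxx in kl.
- by exists k, l.
- by exists l, k; rewrite distrC.
Qed.

Lemma closure_rowP A p :
  closure A p <-> forall e, 0 < e -> exists2 q, A q & `|p - q| < e.
Proof.
split=> [Ap e e0|h B].
  have /Ap [q [Aq]] : nbhs p (ball p e) by apply: nbhsx_ballx.
  by rewrite mx_norm_ball /ball_ /=; exists q.
move=> /nbhs_ballP [e /= e0 eB]; have [q Aq pq] := h e e0.
by exists q; split => //; apply: eB; rewrite mx_norm_ball.
Qed.

Lemma closed_rowP A : closed A <->
  forall p, (forall e, 0 < e -> exists2 q, A q & `|p - q| < e) -> A p.
Proof. by split=> h p; [move/closure_rowP/h|move/closure_rowP/h]. Qed.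

(** A chain of nonempty sets is a basis of a proper filter, which clusters because it lives on a
    compact ball. *)
Lemma chain_cluster (C : set (set 'rV[R]_d)) B :
  C !=set0 -> (forall A A', C A -> C A' -> A `<=` A' \/ A' `<=` A) ->
  (forall A, C A -> A !=set0) ->
  (forall A w, C A -> A w -> `|w| <= B) ->
  exists p, forall A, C A -> closure A p.
Proof.
move=> C0 tot ne bnd; pose K := [set w : 'rV[R]_d | `|w| <= B].
have cK : compact K.
  apply: bounded_closed_compact.
    by exists B; split; [exact: num_real|move=> x Bx w Kw; apply: le_trans Kw (ltW Bx)].
  apply/closed_rowP => p pK; rewrite /K /= leNgt; apply/negP => Bp.
  have [|q Kq pq] := pK (`|p| - B); first by rewrite subr_gt0.
  have := ler_normD (p - q) q; rewrite subrK.
  by move: Kq; rewrite /K /=; lra.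
have FF : ProperFilter (filter_from C id).
  apply: filter_from_proper; last exact: ne.
  apply: filter_from_filter; first by case: C0 => A; exists A.
  move=> A A' CA CA'; have [s|s] := tot _ _ CA CA'.
    by exists A => // w Aw; split => //; apply: s.
  by exists A' => // w Aw; split => //; apply: s.
have [A CA] := C0.
have [|p [_ pP]] := cK _ FF; first by exists A => // w; apply: bnd.
by exists p => A' CA' U Up; apply: pP => //; exists A'.
Qed.

(** Serves to pass to the limit: [P e] collects bounded points that solve a problem up to an error
    [e]. *)
Lemma shrinking_cluster (P : R -> set 'rV[R]_d) B :
  (forall e e', 0 < e -> e <= e' -> P e `<=` P e') ->
  (forall e, 0 < e -> P e !=set0) ->
  (forall e w, 0 < e -> P e w -> `|w| <= B) ->
  exists p, forall e, 0 < e -> exists2 q, P e q & `|p - q| < e.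
Proof.
move=> mono ne bnd; have [||||p pP] := @chain_cluster [set P e | e in [set e | 0 < e]] B.
- by exists (P 1), 1 => //=.
- move=> _ _ [e /= e0 <-] [e' /= e'0 <-].
  by have [ee'|/ltW ee'] := leP e e'; [left|right]; apply: mono.
- by move=> _ [e e0 <-]; apply: ne.
- by move=> _ w [e e0 <-]; apply: bnd.
exists p => e e0; have /closure_rowP : closure (P e) p by apply: pP; exists e.
by move/(_ e e0).
Qed.

End Row.
End Real.

(** * The lattice *)

Section Zspan.
Variables (d : nat) (K : fieldExtType rat) (b : d.-tuple K).
Local Notation L := (zspan b).
Implicit Types x y : K.

Lemma zspan_basis j : L (tnth b j).
Proof.
exists (fun k => (k == j)%:Z); rewrite (bigD1 j) //= eqxx big1 ?addr0 // => k.
by move=> /negPf ->.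
Qed.

Lemma zspan0 : L 0.
Proof. by exists (fun=> 0); rewrite big1. Qed.

Lemma zspanB x y : L x -> L y -> L (x - y).
Proof.
move=> [z ->] [z' ->]; exists (fun j => z j - z' j); rewrite -sumrB.
by apply: eq_bigr => j _; rewrite mulrzBr.
Qed.

Lemma zspanN x : L x -> L (- x).
Proof. by move=> Lx; rewrite -sub0r; apply: zspanB => //; apply: zspan0. Qed.

Lemma zspanD x y : L x -> L y -> L (x + y).
Proof. by move=> Lx Ly; rewrite -[y]opprK; apply: zspanB => //; apply: zspanN. Qed.

Lemma zspanMz x m : L x -> L (x *~ m).
Proof.
move=> [z ->]; exists (fun j => z j * m); rewrite -mulrzl mulr_sumr.
by apply: eq_bigr => j _; rewrite mulrzA mulrzl.
Qed.

Lemma zspanMn x n : L x -> L (x *+ n).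
Proof. by rewrite -[n]/(`|n|%N) pmulrn; apply: zspanMz. Qed.

Lemma zspan_sum (I : finType) (F : I -> K) : (forall i, L (F i)) -> L (\sum_i F i).
Proof. by move=> h; elim/big_ind: _ => //; [apply: zspan0|apply: zspanD]. Qed.

(** The multiplier ring of the lattice, an order of K when [b] is a basis. *)
Definition zspan_stab x := forall y, L y -> L (x * y).

Lemma zspan_stab_basis x : (forall j, L (x * tnth b j)) -> zspan_stab x.
Proof.
move=> h _ [z ->]; rewrite mulr_sumr; apply: zspan_sum => j.
by rewrite mulrzAr; apply: zspanMz.
Qed.

Lemma zspan_stabM x y : zspan_stab x -> zspan_stab y -> zspan_stab (x * y).
Proof. by move=> hx hy w Lw; rewrite -mulrA; apply/hx/hy. Qed.

Lemma zspan_stab1 : zspan_stab 1.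
Proof. by move=> w; rewrite mul1r. Qed.

Lemma zspan_stab_matrix x : zspan_stab x ->
  exists A : 'M[int]_d, forall k, x * tnth b k = \sum_j tnth b j *~ A j k.
Proof.
move=> sx; have /choice [f fP] k := sx _ (zspan_basis k).
by exists (\matrix_(j, k) f k j) => k; rewrite fP; apply: eq_bigr => j _; rewrite mxE.
Qed.

Hypothesis b_basis : basis_of {:K} b.

Lemma zspan_torsion x : exists2 n, (0 < n)%N & forall m, (n %| m)%N -> L (x *+ m).
Proof.
have [n n0 nP] : exists2 n, (0 < n)%N & forall j, L ((coord b j x *: tnth b j) *+ n).
  apply: finite_common_multiple => j; set q := coord b j x.
  exists `|denq q|%N; first by rewrite absz_gt0 denq_neq0.
  move=> m /dvdnP [k ->]; rewrite mulnC mulrnA; apply: zspanMn.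
  suff -> : q *: tnth b j *+ `|denq q| = tnth b j *~ numq q.
    by apply: zspanMz; apply: zspan_basis.
  rewrite pmulrn gtz0_abs ?denq_gt0 // -!scaler_int scalerA; congr (_ *: _).
  by rewrite numqE mulrC.
exists n => // m /dvdnP [k ->]; rewrite mulnC mulrnA; apply: zspanMn.
rewrite (coord_basis b_basis (memvf x)) -sumrMnl; apply: zspan_sum => j.
by rewrite -tnth_nth; apply: nP.
Qed.

(** [D] clears the denominators of the products of basis elements. This turns lattice elements into
    multipliers, whose norms are integers. *)
Lemma zspan_order : exists2 D, (0 < D)%N & forall x, L x -> zspan_stab (x *+ D).
Proof.
have [D D0 DP] : exists2 n, (0 < n)%N &
    forall jk : 'I_d * 'I_d, L ((tnth b jk.1 * tnth b jk.2) *+ n).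
  by apply: finite_common_multiple => jk; apply: zspan_torsion.
exists D => // x [z ->]; apply: zspan_stab_basis => k.
rewrite mulrnAl mulr_suml -sumrMnl; apply: zspan_sum => j.
rewrite mulrzAl pmulrn -mulrzA [z j * _]mulrC mulrzA -pmulrn.
by apply: zspanMz; apply: (DP (j, k)).
Qed.

End Zspan.

(** * The embeddings and the norm *)

Section Embedding.
Variables (R : realType) (d : nat) (K : fieldExtType rat).
Variables (sigma : 'I_d -> {rmorphism K -> R}) (b : d.-tuple K).
Local Notation L := (zspan b).
Local Notation E := (embmx sigma b).
Local Notation f := (phi sigma).
Implicit Types x y u : K.

Lemma phiD x y : f (x + y) = f x + f y.
Proof. by apply/rowP => i; rewrite !mxE rmorphD. Qed.
Lemma phiN x : f (- x) = - f x.
Proof. by apply/rowP => i; rewrite !mxE rmorphN. Qed.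
Lemma phiMn x n : f (x *+ n) = f x *+ n.
Proof. by apply/rowP => i; rewrite mulmxnE !mxE rmorphMn. Qed.

(** The field norm from K to the rationals, when the [sigma i] are all the embeddings of K. *)
Definition embnorm x := \prod_i sigma i x.

Lemma embnormM x y : embnorm (x * y) = embnorm x * embnorm y.
Proof. by rewrite -big_split; apply: eq_bigr => i _; rewrite rmorphM. Qed.

Lemma embnormV x : embnorm x^-1 = (embnorm x)^-1.
Proof. by rewrite -prodfV; apply: eq_bigr => i _; rewrite fmorphV. Qed.

Lemma embnorm1 : embnorm 1 = 1.
Proof. by rewrite /embnorm big1 // => i _; rewrite rmorph1. Qed.

Lemma embnorm_neq0 x : x != 0 -> embnorm x != 0.
Proof. by move=> x0; apply/prodf_neq0 => i _; rewrite fmorph_eq0. Qed.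

Hypothesis det_neq0 : \det E != 0.

(* [E * A = diag(sigma x) * E] for the matrix [A] of multiplication by [x], so
   [\det A] is the norm; the adjugate of [A] shows that it is divisible by [x]. *)
Lemma stab_embnorm x : zspan_stab b x -> exists m : int,
  embnorm x = m%:~R /\ forall y, L y -> exists2 w, L w & y *~ m = x * w.
Proof.
move=> /zspan_stab_matrix [A AP]; exists (\det A); split.
  have EA : diag_mx (f x) *m E = E *m map_mx intr A.
    apply/matrixP => i k; rewrite mul_diag_mx !mxE -rmorphM AP rmorph_sum.
    by apply: eq_bigr => j _; rewrite !mxE -[_ *~ _]mulrzl rmorphM rmorph_int mulrC.
  move/(congr1 determinant): EA; rewrite !det_mulmx det_diag mulrC.
  move/(mulfI det_neq0); rewrite det_map_mx => <-.
  by apply: eq_bigr => i _; rewrite mxE.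
move=> _ [z ->].
(* The witness has coordinates [\adj A *m z]; multiplication by [x] applies [A] to them. *)
exists (\sum_l \sum_k (tnth b k *~ (\adj A k l * z l))).
  apply: zspan_sum => l; apply: zspan_sum => k.
  by apply: zspanMz; apply: zspan_basis.
rewrite -mulrzl !mulr_sumr; apply: eq_bigr => l _.
rewrite mulrzl -mulrzA [RHS]mulr_sumr.
under [RHS]eq_bigr => k _ do rewrite mulrzAr AP -mulrzl mulr_sumr.
rewrite exchange_big /=.
transitivity (\sum_j tnth b j *~ ((A *m \adj A) j l * z l)).
  rewrite mul_mx_adj (bigD1 l) //= big1 ?addr0.
    by rewrite mxE eqxx mulr1n mulrC.
  by move=> j /negPf jl; rewrite mxE jl mul0r.
apply: eq_bigr => j _; rewrite mxE mulr_suml -[LHS]mulrzl rmorph_sum mulr_suml.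
by apply: eq_bigr => k _; rewrite !mulrzl -mulrzA mulrA.
Qed.
End Embedding.

(** * Units *)

Section Units.
Variables (R : realType) (d : nat) (K : fieldExtType rat).
Variables (sigma : 'I_d -> {rmorphism K -> R}) (b : d.-tuple K).
Local Notation L := (zspan b).
Local Notation E := (embmx sigma b).
Local Notation f := (phi sigma).
Implicit Types x y u : K.

Hypothesis det_neq0 : \det E != 0.
Hypothesis b_basis : basis_of {:K} b.

Definition embmx_size : R := \sum_i \sum_j `|E i j|.
Local Notation S := (embmx_size).

Lemma embmx_size_ge0 : 0 <= S.
Proof. by apply: sumr_ge0 => i _; apply: sumr_ge0 => j _; apply: normr_ge0. Qed.

Lemma row_combination_le (c : 'I_d -> R) (T : R) i : (forall j, `|c j| <= T) ->
  `|\sum_j E i j * c j| <= S * T.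
Proof.
move=> cT; have T0 : 0 <= T by apply: le_trans (cT i).
apply: le_trans (ler_norm_sum _ _ _) _.
apply: le_trans (_ : (\sum_j `|E i j|) * T <= _).
  by rewrite mulr_suml; apply: ler_sum => j _; rewrite normrM ler_wpM2l.
rewrite ler_wpM2r // /embmx_size [leRHS](bigD1 i) //= lerDl.
by apply: sumr_ge0 => k _; apply: sumr_ge0 => j _; apply: normr_ge0.
Qed.

Lemma sigma_combination (z : 'I_d -> int) i :
  sigma i (\sum_j tnth b j *~ z j) = \sum_j E i j * (z j)%:~R.
Proof.
rewrite rmorph_sum; apply: eq_bigr => j _.
by rewrite -mulrzr rmorphM rmorph_int mxE.
Qed.

Lemma combination_eq0 (z : 'I_d -> int) :
  \sum_j tnth b j *~ z j = 0 -> forall j, z j = 0.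
Proof.
move=> z0 j; have /freeP /(_ (fun j => (z j)%:~R)) : free b := basis_free b_basis.
move=> /(_ _ j) H; apply/eqP; rewrite -(intr_eq0 rat); apply/eqP; apply: H.
by rewrite -[RHS]z0; apply: eq_bigr => k _; rewrite scaler_int -tnth_nth.
Qed.

(* Dirichlet's box principle: the number of boxes is [(t^d)^(d-1)]. *)
Lemma dirichlet : exists2 C : R, 0 < C & forall i t, exists z : 'I_d -> int,
  let x := \sum_j tnth b j *~ z j in
  [/\ x != 0, forall j, j != i -> `|sigma j x| <= C / t.+1%:R
    & `|sigma i x| <= C * t.+1%:R ^+ d.-1].
Proof.
have S0 := embmx_size_ge0.
exists (2 * (S + 1)); first by lra.
move=> i t; have d0 : (0 < d)%N by apply: leq_ltn_trans (ltn_ord i).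
pose T : R := t.+1%:R ^+ d.-1.
have T0 : 0 < T by rewrite exprn_gt0 // ltr0n.
(* With coefficients from 0 to [T] there are [(T + 1)^d] combinations, more than the [T^d] boxes;
   the side [2 * (S + 1) * T / t.+1^d] of a box is [C / t.+1]. *)
pose x (z : {ffun 'I_d -> 'I_(t.+1 ^ d.-1).+1}) := \sum_j tnth b j *~ (z j)%:Z.
have le_T (k : 'I_(t.+1 ^ d.-1).+1) : k%:R <= T.
  by rewrite /T -natrX ler_nat -ltnS.
have [||| z [w [zw zwP]]] := @pigeonhole_cube R _ {j : 'I_d | j != i}
    (t.+1 ^ d) ((S + 1) * T) (fun z j => sigma (val j) (x z)).
- by rewrite expn_gt0.
- move=> z j; apply: le_lt_trans (_ : S * T < _); last by rewrite ltr_pM2r //; lra.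
  rewrite /x sigma_combination; apply: row_combination_le => k.
  by rewrite ger0_norm ?ler0z // le_T.
- rewrite card_ffun !card_ord card_sig.
  have -> : #|[pred j : 'I_d | j != i]| = d.-1 by rewrite cardC1 card_ord.
  rewrite -expnM mulnC expnM ltn_exp2r //.
have xE : x z - x w = \sum_j tnth b j *~ ((z j)%:Z - (w j)%:Z).
  by rewrite /x -sumrB; apply: eq_bigr => j _; rewrite mulrzBr.
exists (fun j => (z j)%:Z - (w j)%:Z); rewrite /= -xE; split.
- apply: contraNneq zw; rewrite xE => /combination_eq0 h; apply/eqP/ffunP => j.
  by apply: val_inj; have := h j => /eqP; rewrite subr_eq0 => /eqP [].
- move=> j ji; rewrite rmorphB; apply: le_trans (ltW (zwP (Sub j ji))) _.
  rewrite natrX -[X in _ ^+ X](prednK d0) exprSr -/T.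
  have t0 : t.+1%:R != 0 :> R by rewrite pnatr_eq0.
  have cancel (r s q : R) : r != 0 -> q != 0 -> 2 * (s * q) / (q * r) = 2 * s / r.
    by move=> r0 q0; field; apply/andP.
  by rewrite cancel // lt0r_neq0.
rewrite xE sigma_combination.
apply: le_trans (row_combination_le _ (_ : forall j, _ <= T)) _.
  move=> j; rewrite rmorphB /= ler_norml.
  have := le_T (z j); have := le_T (w j).
  have : 0 <= (z j)%:R :> R by []. have : 0 <= (w j)%:R :> R by [].
  by move=> *; apply/andP; split; lra.
rewrite ler_wpM2r //; first exact: ltW.
lra.
Qed.

(* The norm condition follows from the other ones; including it avoids proving that. *)
Definition zspan_unit u :=
  [/\ u != 0, `|embnorm sigma u| = 1, zspan_stab b u & zspan_stab b u^-1].

Lemma zspan_unit1 : zspan_unit 1.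
Proof.
by split; rewrite ?oner_eq0 ?embnorm1 ?normr1 ?invr1 //; apply: zspan_stab1.
Qed.

Lemma zspan_unitM u v : zspan_unit u -> zspan_unit v -> zspan_unit (u * v).
Proof.
move=> [u0 nu su su'] [v0 nv sv sv']; split.
- by rewrite mulf_neq0.
- by rewrite embnormM normrM nu nv mulr1.
- exact: zspan_stabM.
- by rewrite invfM; apply: zspan_stabM.
Qed.

Lemma zspan_unitV u : zspan_unit u -> zspan_unit u^-1.
Proof.
move=> [u0 nu su su']; split; rewrite ?invrK ?invr_eq0 //.
by rewrite embnormV normfV nu invr1.
Qed.

Lemma zspan_unitX u n : zspan_unit u -> zspan_unit (u ^+ n).
Proof.
move=> Uu; elim: n => [|n IH]; first by rewrite expr0; apply: zspan_unit1.
by rewrite exprS; apply: zspan_unitM.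
Qed.

(* Congruent elements of equal norm differ by a unit: [m L <= x L] when [x] has norm [m]. *)
Lemma quotient_stab x y (m : int) (M : nat) w :
  x != 0 -> zspan_stab b x -> embnorm sigma x = m%:~R -> (`|m| %| M)%N ->
  zspan_stab b w -> y = x + w *+ M -> zspan_stab b (y / x).
Proof.
move=> x0 sx nx mM sw -> v Lv.
have [m' [nx' div]] := stab_embnorm det_neq0 sx.
have mm' : m' = m by apply/eqP; rewrite -(eqr_int R) -nx nx'.
rewrite mm' in div.
have [q Mq] : exists q, M%:Z = m * q.
  by have /dvdzP [q ->] : (m %| M%:Z)%Z by []; exists q; rewrite mulrC.
have [r Lr rE] := div _ (sw _ Lv).
have -> : (x + w *+ M) / x * v = v + r *~ q.
  apply: (mulfI x0); rewrite mulrC mulrAC mulfVK // mulrDl mulrDr; congr (_ + _).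
  by rewrite mulrnAl pmulrn Mq mulrzA rE mulrzAr.
by apply: zspanD => //; apply: zspanMz.
Qed.

(** The Dirichlet elements for [i], scaled by [D], have bounded norms and tend to 0 at the other
    places. Two of them with equal absolute norm, congruent modulo a multiple of it, have a unit as
    quotient. If the numerator comes late enough, the quotient is below 1 away from [i], and norm 1
    makes it exceed 1 at [i]. *)
Lemma exists_dominant_unit i : (1 < d)%N -> exists u, [/\ zspan_unit u,
  forall j, 0 < sigma j u, 1 < sigma i u & forall j, j != i -> sigma j u < 1].
Proof.
move=> d1; have [C C0 /(_ i)] := dirichlet.
move=> /choice [z zP]; have [D D0 DP] := zspan_order b_basis.
pose x t := \sum_j tnth b j *~ z t j.
have Lx t : L (x t) by exists (z t).
have xD0 t : x t *+ D != 0.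
  rewrite -(scaler_nat (R := rat)) scaler_eq0 pnatr_eq0 negb_or -lt0n D0; by have [] := zP t.
have sx t : zspan_stab b (x t *+ D) by apply: DP.
have /choice [m mP] t : exists m : int, embnorm sigma (x t *+ D) = m%:~R.
  by have [m [mP _]] := stab_embnorm det_neq0 (sx t); exists m.
have m_neq0 t : m t != 0.
  by rewrite -(intr_eq0 R) -mP embnorm_neq0 // xD0.
have sigD t j : `|sigma j (x t *+ D)| = `|sigma j (x t)| * D%:R.
  by rewrite rmorphMn normrMn mulr_natr.
pose B := Num.bound ((C * D%:R) ^+ d).
have CD0 : 0 < C * D%:R by rewrite mulr_gt0 // ltr0n.
have m_lt t : (`|m t| < B)%N.
  rewrite -(ltr_nat R); apply: le_lt_trans _ (archi_boundP _); last first.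
    by rewrite exprn_ge0 // ltW.
  rewrite natr_absz intr_norm -mP normr_prod.
  rewrite (bigD1 i) //=.
  have [_ hj hi] := zP t; rewrite -/(x t) in hj hi.
  have n0 : 0 < t.+1%:R :> R by rewrite ltr0n.
  (* The factor [t.+1 ^ d.-1] at [i] cancels against [1 / t.+1] at each of the other [d.-1]
     places. *)
  apply: le_trans (_ : (C * D%:R * t.+1%:R ^+ d.-1) *
     \prod_(j < d | j != i) (C * D%:R / t.+1%:R) <= _).
    apply: ler_pM => //; first by apply: prodr_ge0.
      by rewrite sigD mulrAC ler_pM2r ?ltr0n.
    apply: ler_prod => j ji; rewrite normr_ge0 sigD mulrAC ler_pM2r ?ltr0n //.
    exact: hj.
  rewrite prodr_const cardC1 card_ord -{3}(prednK (ltnW d1)) exprS expr_div_n.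
  by rewrite mulrACA divff ?mulr1 // expf_neq0 // lt0r_neq0.
(* The norms are nonzero and below [B] in absolute value, so each divides this factorial. *)
pose M := (B`!)%N.
have M0 : (0 < M)%N by rewrite fact_gt0.
(* The class records the absolute norm and the coordinates modulo [M]; some class recurs at
   arbitrarily late indices. *)
pose cl t : 'I_B.+1 * {ffun 'I_d -> 'I_M.+1} :=
  (inord `|m t|%N, [ffun j => inord `|(z t j %% M%:Z)%Z|%N]).
have [c cP] := frequent_value cl.
have [t _ ct] := cP 0%N.
have [T TP] : exists T, forall j, j != i -> forall s, (T <= s)%N ->
    `|sigma j (x s *+ D)| < `|sigma j (x t *+ D)|.
  have [T TP] : exists T, forall j : 'I_d, C * D%:R / `|sigma j (x t *+ D)| < T%:R.
    apply: finite_common_bound => j.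
    exists (Num.bound (C * D%:R / `|sigma j (x t *+ D)|)) => k nk.
    apply: lt_le_trans (archi_boundP _) _; last by rewrite ler_nat.
    by rewrite divr_ge0 // ltW.
  exists T => j ji s Ts.
  have sj0 : 0 < `|sigma j (x t *+ D)| by rewrite normr_gt0 fmorph_eq0.
  rewrite sigD; have [_ hj _] := zP s.
  apply: le_lt_trans (_ : C / s.+1%:R * D%:R < _).
    by rewrite ler_wpM2r ?ler0n //; apply: hj.
  rewrite mulrAC ltr_pdivrMr ?ltr0n // [ltRHS]mulrC -ltr_pdivrMr //.
  by apply: lt_le_trans (TP j) _; rewrite ler_nat ltnW.
have [s Ts cs] := cP T.
have clE : cl s = cl t by rewrite cs ct.
have absE : `|m s|%N = `|m t|%N.
  have : ((cl s).1 : nat) = (cl t).1 by rewrite clE.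
  by rewrite /= !inordK // ltnW // ltnS.
have modE j : (z s j %% M%:Z)%Z = (z t j %% M%:Z)%Z.
  have : ((cl s).2 j : nat) = (cl t).2 j by rewrite clE.
  rewrite /= !ffunE.
  have M0' : M%:Z != 0 by rewrite -lt0n.
  have lt_M k : (`|(k %% M%:Z)%Z| < M.+1)%N.
    by rewrite ltnS ltnW // -ltz_nat gez0_abs ?modz_ge0 // ltz_mod.
  rewrite !inordK // => /(congr1 Posz).
  by rewrite !gez0_abs ?modz_ge0.
have [w Lw wE] : exists2 w, L w & x s = x t + w *+ M.
  exists (\sum_j tnth b j *~ ((z s j %/ M%:Z)%Z - (z t j %/ M%:Z)%Z)).
    by eexists.
  rewrite /x -sumrMnl -big_split; apply: eq_bigr => j _ /=.
  rewrite pmulrn -mulrzA -mulrzDr; congr (_ *~ _).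
  by rewrite {1}(divz_eq (z s j) M) modE mulrBl {2}(divz_eq (z t j) M); ring.
have dvdM r : (`|m r| %| M)%N.
  by apply: dvdn_fact; rewrite lt0n absz_eq0 m_neq0 /= ltnW.
have sw : zspan_stab b (w *+ D) by apply: DP.
have U : zspan_unit (x s *+ D / (x t *+ D)).
  split; first by rewrite mulf_neq0 ?invr_eq0.
  - rewrite embnormM embnormV normrM normfV !mP -!intr_norm -!abszE absE.
    by rewrite divff // intr_eq0 abszE normr_eq0.
  - apply: (quotient_stab (xD0 t) (sx t) (mP t) (dvdM t) sw).
    by rewrite wE mulrnDl -!mulrnA mulnC.
  - rewrite invf_div; apply: (quotient_stab (xD0 s) (sx s) (mP s) (dvdM s) (w := - w *+ D)).
      by move=> y Ly; rewrite mulNrn mulNr; apply: zspanN; apply: sw.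
    by rewrite wE mulrnDl mulNrn mulNrn -!mulrnA mulnC addrK.
pose v := x s *+ D / (x t *+ D); rewrite -/v in U.
have v_lt1 j : j != i -> `|sigma j v| < 1.
  move=> ji; rewrite rmorphM fmorphV normrM normfV ltr_pdivrMr.
    by rewrite mul1r; apply: TP.
  by rewrite normr_gt0 fmorph_eq0.
have v_gt1 : 1 < `|sigma i v|.
  rewrite ltNge; apply/negP => vi.
  (* The place [k] contributes a factor strictly below 1, so the absolute norm would be below 1. *)
  have [k ki] : exists k, k != i.
    have [|k] := @exists_notin_seq 'I_d [:: i]; first by rewrite card_ord.
    by rewrite inE => ki; exists k.
  have [_ nv _ _] := U; move: nv; rewrite normr_prod (bigD1 k) //= => nv.
  suff : `|sigma k v| * \prod_(j < d | j != k) `|sigma j v| < 1 by rewrite nv ltxx.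
  apply: le_lt_trans (v_lt1 _ ki); rewrite ger_pMr ?normr_gt0 ?fmorph_eq0; last by case: U.
  apply: prodr_ile1 => j _; rewrite normr_ge0 /=.
  by have [->//|/v_lt1/ltW] := eqVneq j i.
(* Squaring makes all embeddings positive and keeps the inequalities. *)
have sq j : sigma j (v ^+ 2) = `|sigma j v| ^+ 2 by rewrite rmorphXn real_normK ?num_real.
exists (v ^+ 2); split.
- exact: zspan_unitX.
- by move=> j; rewrite sq exprn_gt0 // normr_gt0 fmorph_eq0; case: U.
- by rewrite sq exprn_egt1.
- by move=> j ji; rewrite sq exprn_ilt1 // v_lt1.
Qed.

End Units.

(** * The action of the units *)

Section Dynamics.
Variables (R : realType) (d : nat) (K : fieldExtType rat).
Variables (sigma : 'I_d -> {rmorphism K -> R}) (b : d.-tuple K).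
Local Notation L := (zspan b).
Local Notation E := (embmx sigma b).
Local Notation f := (phi sigma).
Implicit Types (x y u v : K) (w p q : 'rV[R]_d) (n : nat).

Hypothesis det_neq0 : \det E != 0.
Hypothesis b_basis : basis_of {:K} b.

Definition act u w : 'rV[R]_d := \row_i (sigma i u * w 0 i).

Lemma actM u v w : act (u * v) w = act u (act v w).
Proof. by apply/rowP => i; rewrite !mxE rmorphM mulrA. Qed.

Lemma act1 w : act 1 w = w.
Proof. by apply/rowP => i; rewrite !mxE rmorph1 mul1r. Qed.

Lemma actD u w p : act u (w + p) = act u w + act u p.
Proof. by apply/rowP => i; rewrite !mxE mulrDr. Qed.

Lemma actN u w : act u (- w) = - act u w.
Proof. by apply/rowP => i; rewrite !mxE mulrN. Qed.

Lemma actB u w p : act u (w - p) = act u w - act u p.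
Proof. by rewrite actD actN. Qed.

Lemma actBl u v w : act (u - v) w = act u w - act v w.
Proof. by apply/rowP => i; rewrite !mxE rmorphB mulrBl. Qed.

Lemma actZ u (t : R) w : act u (t *: w) = t *: act u w.
Proof. by apply/rowP => i; rewrite !mxE mulrCA. Qed.

Lemma actMn u w n : act u (w *+ n) = act u w *+ n.
Proof. by apply/rowP => i; rewrite mulmxnE !mxE mulmxnE mulrnAr. Qed.

Lemma act_phi u x : act u (f x) = f (u * x).
Proof. by apply/rowP => i; rewrite !mxE rmorphM. Qed.

Lemma actVK u w : u != 0 -> act u (act u^-1 w) = w.
Proof. by move=> u0; rewrite -actM divff // act1. Qed.

Lemma actKV u w : u != 0 -> act u^-1 (act u w) = w.
Proof. by move=> u0; rewrite -actM mulVf // act1. Qed.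

Lemma normN_act u w : normN (act u w) = embnorm sigma u * normN w.
Proof. by rewrite /normN -big_split; apply: eq_bigr => i _; rewrite mxE. Qed.

Lemma act_bounded u : exists2 C : R, 0 < C & forall w, `|act u w| <= C * `|w|.
Proof.
exists (1 + \sum_i `|sigma i u|).
  by rewrite ltr_wpDr // sumr_ge0.
move=> w; have S0 : 0 <= 1 + \sum_i `|sigma i u| by rewrite addr_ge0 // sumr_ge0.
apply: row_norm_le => [|i]; first by rewrite mulr_ge0.
rewrite mxE normrM ler_pM ?coord_le_norm //.
by rewrite (bigD1 i) //= addrCA lerDl addr_ge0 // sumr_ge0.
Qed.

(** Rounding down the coordinates of [w] in the real basis given by the columns of [E] leaves
    coefficients in [0, 1). *)
Lemma zspan_cover : exists2 B : R, 0 < B & forall w, exists2 x, L x & `|w - f x| < B.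
Proof.
have S0 := embmx_size_ge0 sigma b.
exists (embmx_size sigma b + 1); first by rewrite ltr_wpDl.
move=> w; have Eu : E^T \in unitmx by rewrite unitmx_tr unitmxE unitfE.
pose c := w *m invmx E^T.
exists (\sum_j tnth b j *~ Num.floor (c 0 j)); first by eexists.
apply: le_lt_trans (_ : embmx_size sigma b * 1 < _); last by rewrite mulr1 ltrDl.
apply: row_norm_le; first by rewrite mulr1.
move=> i; rewrite [X in `|X|](_ : _ =
    \sum_j E i j * (c 0 j - (Num.floor (c 0 j))%:~R)).
  apply: row_combination_le => j; have /andP[] := floor_itv (c 0 j).
  by rewrite rmorphD /= => h1 h2; rewrite ger0_norm; lra.
rewrite !mxE sigma_combination -{1}(mulmxKV Eu w) -/c mxE -sumrB.
by apply: eq_bigr => j _; rewrite [E^T _ _]mxE mulrBr [c 0 j * _]mulrC.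
Qed.

(* These units fix the [n]-division points of [L] modulo [L]; for [n = 1] they are all units. *)
Definition congruence_unit n u :=
  zspan_unit sigma b u /\ forall x, L x -> exists2 y, L y & (u - 1) * x = y *+ n.
Local Notation G := congruence_unit.

Lemma congruence_unit_one u : zspan_unit sigma b u -> G 1 u.
Proof.
move=> Uu; split=> // x Lx; exists ((u - 1) * x) => //.
by rewrite mulrBl mul1r; apply: zspanB => //; case: Uu => _ _ + _; apply.
Qed.

Lemma congruence_unit1 n : G n 1.
Proof.
split; first exact: zspan_unit1.
by move=> x Lx; exists 0; rewrite ?subrr ?mul0r ?mul0rn //; apply: zspan0.
Qed.

Lemma congruence_unitM n u v : G n u -> G n v -> G n (u * v).
Proof.
move=> [Uu Gu] [Uv Gv]; split; first exact: zspan_unitM.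
move=> x Lx; have [y Ly yE] := Gv x Lx; have [y' Ly' y'E] := Gu x Lx.
exists (u * y + y').
  by apply: zspanD => //; case: Uu => _ _ + _; apply.
by rewrite mulrnDl -y'E -mulrnAr -yE; ring.
Qed.

Lemma congruence_unitV n u : G n u -> G n u^-1.
Proof.
move=> [Uu Gu]; split; first exact: zspan_unitV.
have [u0 _ _ su'] := Uu.
move=> x Lx; have [y Ly yE] := Gu _ (su' _ Lx); exists (- y); first exact: zspanN.
by rewrite mulNrn -yE; field.
Qed.

Lemma congruence_unitX n u k : G n u -> G n (u ^+ k).
Proof.
move=> Gu; elim: k => [|k IH]; first by rewrite expr0; apply: congruence_unit1.
by rewrite exprS; apply: congruence_unitM.
Qed.

Lemma congruence_unit_neq0 n u : G n u -> u != 0.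
Proof. by case=> -[]. Qed.

(** Modulo [n], the powers of [u] act on the basis by finitely many matrices. Two powers agree, and
    dividing by the earlier one leaves a power congruent to 1. *)
Lemma congruence_unit_expr n u : (0 < n)%N -> zspan_unit sigma b u ->
  exists2 k, (0 < k)%N & G n (u ^+ k).
Proof.
move=> n0 Uu; have n0' : n%:Z != 0 by rewrite -lt0n.
have stabX k : zspan_stab b (u ^+ k) by have [] := zspan_unitX k Uu.
have /choice [z zP] (kj : nat * 'I_d) := stabX kj.1 _ (zspan_basis b kj.2).
pose c k : {ffun 'I_d * 'I_d -> 'I_n.+1} :=
  [ffun ij => inord `|(z (k, ij.1) ij.2 %% n%:Z)%Z|%N].
have [c0 cP] := frequent_value c.
have [k _ ck] := cP 0%N; have [l kl cl] := cP k.+1.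
have modE i j : (z (l, i) j %% n%:Z)%Z = (z (k, i) j %% n%:Z)%Z.
  have : (c l (i, j) : nat) = c k (i, j) by rewrite cl ck.
  rewrite !ffunE /=.
  have lt_n m : (`|(m %% n%:Z)%Z| < n.+1)%N.
    by rewrite ltnS ltnW // -ltz_nat gez0_abs ?modz_ge0 // ltz_mod.
  rewrite !inordK // => /(congr1 Posz).
  by rewrite !gez0_abs ?modz_ge0.
have base i : exists2 y, L y & (u ^+ l - u ^+ k) * tnth b i = y *+ n.
  exists (\sum_j tnth b j *~ ((z (l, i) j %/ n%:Z)%Z - (z (k, i) j %/ n%:Z)%Z)).
    by eexists.
  have := zP (l, i); have := zP (k, i); rewrite /= mulrBl => -> ->.
  rewrite -sumrB -sumrMnl; apply: eq_bigr => j _.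
  rewrite pmulrn -mulrzA -mulrzBr; congr (_ *~ _).
  rewrite mulrBl {1}(divz_eq (z (l, i) j) n) modE [X in _ - X = _](divz_eq _ n%:Z).
  by rewrite [X in _ - X]addrC addrKA.
have {}base x : L x -> exists2 y, L y & (u ^+ l - u ^+ k) * x = y *+ n.
  move=> [t ->]; have /choice [y yP] i : exists y, L y /\ (u ^+ l - u ^+ k) * tnth b i = y *+ n.
    by have [y] := base i; exists y.
  exists (\sum_i y i *~ t i).
    by apply: zspan_sum => i; apply: zspanMz; case: (yP i).
  rewrite mulr_sumr -sumrMnl; apply: eq_bigr => i _.
  by rewrite mulrzAr (yP i).2 !pmulrn -!mulrzA mulrC.
exists (l - k)%N; first by rewrite subn_gt0.
split; first exact: zspan_unitX.
move=> x Lx; have [uk0 _ _ sV] := zspan_unitX k Uu.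
have [y Ly yE] := base x Lx; exists ((u ^+ k)^-1 * y); first exact: sV.
rewrite -mulrnAr -yE mulrA mulrBr mulVf // -exprVn; congr ((_ - 1) * _).
by rewrite -{2}(subnK (ltnW kl)) exprD mulrCA exprVn mulVf // mulr1.
Qed.

Definition dominant i u :=
  [/\ forall j, 0 < sigma j u, 1 < sigma i u & forall j, j != i -> sigma j u < 1].

Lemma exists_dominant_congruence_unit n i : (1 < d)%N -> (0 < n)%N ->
  exists2 u, G n u & dominant i u.
Proof.
move=> d1 n0; have [u [Uu u0 u1 uj]] := exists_dominant_unit det_neq0 b_basis i d1.
have [k k0 Gk] := congruence_unit_expr n0 Uu.
exists (u ^+ k) => //; split=> [j||j ji]; rewrite rmorphXn /=.
- by rewrite exprn_gt0.
- by rewrite exprn_egt1 // -lt0n.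
- by rewrite exprn_ilt1 ?uj // -?lt0n // ltW.
Qed.

(* Two units dominant at different places are multiplicatively independent when a
   third place exists, so their images under [sigma i] accumulate at 1. *)
Lemma congruence_unit_near1 n i e : (2 < d)%N -> (0 < n)%N -> 0 < e ->
  exists2 h, G n h & 1 < sigma i h < 1 + e.
Proof.
move=> d2 n0 e0; have d1 := ltnW d2.
have [j [r [ji ri rj]]] : exists j r : 'I_d, [/\ j != i, r != i & r != j].
  have [|j] := @exists_notin_seq 'I_d [:: i]; first by rewrite card_ord.
  rewrite inE => ji.
  have [|r] := @exists_notin_seq 'I_d [:: i; j]; first by rewrite card_ord.
  rewrite !inE negb_or.
  by move=> /andP[ri rj]; exists j, r.
have [a Ga [a0 ai aj]] := exists_dominant_congruence_unit i d1 n0.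
have [c Gc [c0 cj ci]] := exists_dominant_congruence_unit j d1 n0.
(* Powers of [a] bring [c ^+ k], at most 1 at [i], into the window (1 / sigma i a, 1] there. *)
have /choice [m mP] k : exists m, sigma i c ^+ k * sigma i a ^+ m <= 1
    < sigma i c ^+ k * sigma i a ^+ m.+1.
  apply: expr_floor => //; first by rewrite exprn_gt0.
  by rewrite exprn_ile1 ?ltW // ci // eq_sym.
pose g k := c ^+ k * a ^+ m k; pose v k := sigma i (g k).
have gG k : G n (g k) by apply: congruence_unitM; apply: congruence_unitX.
have vE k : v k = sigma i c ^+ k * sigma i a ^+ m k by rewrite /v /g rmorphM !rmorphXn.
have v0 k : 0 < v k by rewrite vE mulr_gt0 // exprn_gt0.
have v_le k : v k <= 1 by have /andP[] := mP k; rewrite vE.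
have v_ge k : 1 < v k * sigma i a by have /andP[] := mP k; rewrite vE exprSr mulrA.
(* Equality would give [c ^+ (l - k) * a ^+ (m l - m k) = 1]. With [m k <= m l] this fails at the
   third place [r], where both units are below 1. Otherwise a power of [c] equals a power of [a],
   which fails at [i]. *)
have v_inj k l : (k < l)%N -> v k != v l.
  move=> kl; apply/eqP => /fmorph_inj; rewrite /g.
  have -> : c ^+ l = c ^+ k * c ^+ (l - k) by rewrite -exprD subnKC // ltnW.
  rewrite -mulrA.
  have c0' := congruence_unit_neq0 (congruence_unitX k Gc).
  move/(mulfI c0'); have lk0 : (l - k != 0)%N by rewrite -lt0n subn_gt0.
  have [mkl|mlk] := leqP (m k) (m l).
    have -> : a ^+ m l = a ^+ m k * a ^+ (m l - m k) by rewrite -exprD subnKC.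
    rewrite mulrCA -[LHS]mulr1.
    move/(mulfI (congruence_unit_neq0 (congruence_unitX _ Ga))) /(congr1 (sigma r)).
    rewrite rmorph1 rmorphM !rmorphXn /= => h.
    have : sigma r c ^+ (l - k) * sigma r a ^+ (m l - m k) < 1.
      apply: le_lt_trans (_ : sigma r c ^+ (l - k) < _).
        by rewrite ger_pMr ?exprn_gt0 // exprn_ile1 ?ltW // aj.
      by rewrite exprn_ilt1 ?ci // ltW.
    by rewrite -h ltxx.
  have -> : a ^+ m k = a ^+ (m k - m l) * a ^+ m l by rewrite -exprD subnK // ltnW.
  move/(mulIf (congruence_unit_neq0 (congruence_unitX _ Ga))) /(congr1 (sigma i)).
  rewrite !rmorphXn /= => h.
  have : 1 < sigma i a ^+ (m k - m l) by rewrite exprn_egt1 // -lt0n subn_gt0.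
  by rewrite h ltNge exprn_ile1 ?ltW // ci // eq_sym.
(* As [v l > 1 / sigma i a], a gap below [e / sigma i a] divided by [v l] is below [e]. *)
have ratio k l : v l < v k -> v k - v l < e / sigma i a ->
    exists2 h, G n h & 1 < sigma i h < 1 + e.
  move=> lk kl; exists (g k / g l).
    by apply: congruence_unitM => //; apply: congruence_unitV.
  rewrite rmorphM fmorphV -/(v k) -/(v l) ltr_pdivlMr // mul1r lk /=.
  rewrite ltr_pdivrMr // mulrDl mul1r -ltrBlDl; apply: lt_trans kl _.
  rewrite ltr_pdivrMr // -mulrA -[ltLHS]mulr1 ltr_pM2l //.
have [||k [l [kl klP]]] := @bounded_seq_close_pair R 1 (fun k => \row__ v k) 2 (e / sigma i a).
- move=> k; apply: row_norm_lt => // z; rewrite mxE gtr0_norm //.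
  by apply: le_lt_trans (v_le k) _; rewrite ltr1n.
- by rewrite divr_gt0.
have {klP} : `|v k - v l| < e / sigma i a.
  apply: le_lt_trans klP; by apply: le_trans (coord_le_norm _ 0); rewrite !mxE.
have := v_inj _ _ kl; rewrite neq_lt => /orP[lt_kl|lt_lk].
- by rewrite distrC gtr0_norm ?subr_gt0 //; apply: ratio.
- by rewrite gtr0_norm ?subr_gt0 //; apply: ratio.
Qed.
End Dynamics.

(** * Orbit closures *)

Section Orbits.
Variables (R : realType) (d : nat) (K : fieldExtType rat).
Variables (sigma : 'I_d -> {rmorphism K -> R}) (b : d.-tuple K).
Local Notation L := (zspan b).
Local Notation E := (embmx sigma b).
Local Notation f := (phi sigma).
Local Notation G := (congruence_unit sigma b).
Local Notation act := (act sigma).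
Implicit Types (x y u v : K) (w p q : 'rV[R]_d) (n : nat) (F M : set 'rV[R]_d).

Hypothesis det_neq0 : \det E != 0.
Hypothesis b_basis : basis_of {:K} b.

(** Closed invariant subsets of the torus R^d / f L, described by their preimages in R^d. *)
Record orbit_closed n F : Prop := OrbitClosed {
  orbit_closed_closed : closed F;
  orbit_closed_act : forall u w, G n u -> F w -> F (act u w);
  orbit_closed_add : forall x w, L x -> F w -> F (w + f x) }.

Lemma orbit_closed_sub n F x w : orbit_closed n F -> L x -> F w -> F (w - f x).
Proof. by move=> oF Lx Fw; rewrite -phiN; apply: oF.(orbit_closed_add) => //; apply: zspanN. Qed.

(** Zorn's lemma for unions, applied to complements. The intersection of a chain is nonempty because
    translation by L gives each member points in one fixed ball. *)
Lemma orbit_closed_minimal n F : orbit_closed n F -> F !=set0 ->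
  exists M, [/\ M `<=` F, orbit_closed n M, M !=set0 &
    forall M', orbit_closed n M' -> M' !=set0 -> M' `<=` M -> M `<=` M'].
Proof.
move=> oF F0; pose P A := orbit_closed n (~` A) /\ (F `&` ~` A) !=set0.
have oI F1 F2 : orbit_closed n F1 -> orbit_closed n F2 -> orbit_closed n (F1 `&` F2).
  move=> [c1 a1 t1] [c2 a2 t2]; split; first exact: closedI.
    by move=> u w Gu [w1 w2]; split; [apply: a1|apply: a2].
  by move=> x w Lx [w1 w2]; split; [apply: t1|apply: t2].
have [C CP totC|A [[oA [w [Fw nAw]]] maxA]] := @Zorn_bigcup _ P.
  split.
    split.
    - rewrite setC_bigcup; apply: closed_bigI => A CA.
      exact: (CP _ CA).1.(orbit_closed_closed).
    - move=> u w Gu /= nw [A CA Auw]; apply: (CP _ CA).1.(orbit_closed_act) Auw => //.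
      by move=> Aw; apply: nw; exists A.
    - move=> x w Lx /= nw [A CA Axw]; apply: (CP _ CA).1.(orbit_closed_add) Axw => //.
      by move=> Aw; apply: nw; exists A.
  (* The empty chain has empty union, whose complement is the whole space and meets [F]. *)
  have [C0|nC0] := pselect (C !=set0); last first.
    have [w Fw] := F0; exists w; split => //= -[A CA _].
    by apply: nC0; exists A.
  have [B _ BP] := zspan_cover det_neq0.
  pose H := [set [set w | [/\ F w, ~ A w & `|w| <= B]] | A in C].
  have [||||p pP] := @chain_cluster R d H B.
  - by case: C0 => A CA; exists [set w | [/\ F w, ~ A w & `|w| <= B]], A.
  - move=> _ _ [A CA <-] [A' CA' <-].
    have [s|s] := totC _ _ CA CA'; [right|left] => w /= [Fw nw wB]; split => // /s //.
  - move=> _ [A CA <-]; have [oA [w [Fw nw]]] := CP _ CA.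
    have [x Lx xB] := BP w; exists (w - f x); split; last exact: ltW.
      exact: orbit_closed_sub oF _ _.
    exact: orbit_closed_sub oA _ _.
  - by move=> _ w [A CA <-] [].
  have FA A : C A -> F p /\ ~ A p.
    move=> CA; have := pP _ (ex_intro2 _ _ A CA erefl).
    have [oA _] := CP _ CA; move=> clp; split.
      by apply: oF.(orbit_closed_closed); apply: closureS clp => w [].
    by apply: oA.(orbit_closed_closed); apply: closureS clp => w [].
  exists p; split; first by have [A CA] := C0; exact: (FA _ CA).1.
  by move=> [A CA]; exact: (FA _ CA).2.
exists (F `&` ~` A); split.
- by move=> ? [].
- exact: oI.
- by exists w.
move=> M' oM' M'0 sM' q [Fq nAq]; apply: contrapT => nM'q.
apply: (maxA (~` M')).
  split; first by move=> r Ar M'r; have [_] := sM' _ M'r.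
  by move=> /(_ q nM'q).
split; first by rewrite setCK.
by rewrite setCK; have [r M'r] := M'0; exists r; split => //; have [] := sM' _ M'r.
Qed.

(* Expanding a small nonzero vector along the [i]-th axis while the other
   coordinates shrink yields a point of the axis; the multiplicative density of
   [sigma i] then fills the axis, and the axis is dense modulo [L]. *)
Lemma orbit_closed_full n F : (2 < d)%N -> (0 < n)%N -> orbit_closed n F ->
  (forall w, F w -> F (- w)) ->
  (forall e, 0 < e -> exists w, [/\ F w, w != 0 & `|w| < e]) ->
  F = setT.
Proof.
move=> d2 n0 oF FN F0; have d1 := ltnW d2.
have clF := (closed_rowP F).1 oF.(orbit_closed_closed).
(* If each coordinate vanished at all points of [F] close enough to 0, those points would be 0. *)
have [i iP] : exists i, forall e, 0 < e -> exists w, [/\ F w, w 0 i != 0 & `|w| < e].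
  apply: contrapT => /forallNP h.
  have [N NP] : exists N : nat, forall i w, F w -> `|w| < N.+1%:R^-1 -> w 0 i = 0.
    apply: finite_common_bound => i.
    have /existsNP [e /not_implyP [e0 /forallNP eP]] := h i.
    exists (Num.bound e^-1) => m em w Fw wm; apply/eqP; apply: contrapT => /negP wi.
    apply: (eP w); split => //; apply: lt_le_trans wm _.
    rewrite invf_ple ?posrE ?ltr0n //.
    apply: le_trans (ltW (archi_boundP _)) _; first by rewrite invr_ge0 ltW.
    by rewrite ler_nat leqW.
  have [|w [Fw /eqP w0 wN]] := F0 N.+1%:R^-1; first by rewrite invr_gt0 ltr0n.
  by apply: w0; apply/rowP => i; rewrite mxE; apply: NP wN.
have [g Gg [g0 gi gj]] := exists_dominant_congruence_unit det_neq0 b_basis i d1 n0.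
pose ei : 'rV[R]_d := delta_mx 0 i.
have act_ei u t : act u (t *: ei) = (sigma i u * t) *: ei.
  apply/rowP => j; rewrite !mxE eqxx /=; have [->|_] := eqVneq j i; first by rewrite !mulr1.
  by rewrite !mulr0.
have ei_norm t : `|t *: ei| <= `|t|.
  apply: row_norm_le => // j; rewrite !mxE eqxx /=.
  by case: eqP => _; rewrite ?mulr1 ?mulr0 ?normr0.
have gV1 : 0 < (sigma i g)^-1 by rewrite invr_gt0.
have [t t0 Ft] : exists2 t, t != 0 & F (t *: ei).
  (* A power of [g] lifts [w 0 i] into [1 / sigma i g, 1] without enlarging the other coordinates,
     so a cluster point lies on the axis and is not 0. The 1 in the minimum keeps these sets
     bounded. *)
  pose P (e : R) := [set w | [/\ F w, (sigma i g)^-1 <= `|w 0 i| <= 1 &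
    forall j, j != i -> `|w 0 j| < Num.min e 1]].
  have [|||p pP] := @shrinking_cluster R d P 1.
  - move=> e e' e0 ee' w [Fw wi wj]; split => // j /wj.
    by rewrite !lt_min => /andP[h ->]; rewrite (lt_le_trans h).
  - move=> e e0; have [|w [Fw wi]] := iP (Num.min e 1); first by rewrite lt_min e0 ltr01.
    move=> w_lt; have w_lt' j := le_lt_trans (coord_le_norm w j) w_lt.
    have wi0 : 0 < `|w 0 i| by rewrite normr_gt0.
    have wi1 : `|w 0 i| <= 1.
      by have := w_lt' i; rewrite lt_min => /andP[_ /ltW].
    have [k /andP[k1 k2]] := expr_floor gi wi0 wi1.
    have norm_act j : `|act (g ^+ k) w 0 j| = `|w 0 j| * sigma j g ^+ k.
      by rewrite mxE normrM rmorphXn /= gtr0_norm ?exprn_gt0 // mulrC.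
    exists (act (g ^+ k) w); split.
    + by apply: oF.(orbit_closed_act) => //; apply: congruence_unitX.
    + rewrite norm_act k1 andbT -[leLHS]mul1r ler_pdivrMr //.
      by rewrite -mulrA -exprSr ltW.
    + move=> j ji; rewrite norm_act; apply: le_lt_trans (w_lt' j).
      by rewrite ler_piMr // exprn_ile1 ?ltW // gj.
  - move=> e w e0 [_ /andP[_ wi] wj]; apply: row_norm_le => // j.
    have [->//|/wj] := eqVneq j i.
    by rewrite lt_min => /andP[_ /ltW].
  have pE : p = p 0 i *: ei.
    apply/rowP => j; rewrite !mxE eqxx /=; have [->|ji] := eqVneq j i.
      by rewrite mulr1.
    rewrite mulr0; apply/eqP; rewrite -normr_le0 leNgt; apply/negP => pj.
    have [|q [_ _ qj] pq] := pP (`|p 0 j| / 2); first by rewrite divr_gt0.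
    have := qj _ ji; rewrite lt_min => /andP[{}qj _].
    have := le_lt_trans (coord_le_norm _ j) pq; rewrite !mxE => pqj.
    by have := ler_normD (p 0 j - q 0 j) (q 0 j); rewrite subrK; lra.
  exists (p 0 i); last by rewrite -pE; apply: clF => e /pP [q []]; exists q.
  apply/eqP => pi0; have [q [_ /andP[qi _] _] pq] := pP _ gV1.
  have := le_lt_trans (coord_le_norm _ i) pq; rewrite !mxE pi0 sub0r normrN.
  by rewrite ltNge qi.
(* Powers of the inverse of [g] carry an axis point of [F] below [s]; powers of a unit between 1 and
   [1 + e / s] at [i] then climb to within [e] of [s]. *)
have Fpos s : 0 < s -> F (s *: ei).
  have {t t0 Ft} [t t0 Ft] : exists2 t, 0 < t & F (t *: ei).
    move: t0; rewrite neq_lt => /orP[tn|tp]; last by exists t.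
    by exists (- t); rewrite ?oppr_gt0 // scaleNr; apply: FN.
  have gV_lt1 : (sigma i g)^-1 < 1 by rewrite invf_lt1 //; apply: lt_trans gi.
  move=> s0; have [k /(_ k (leqnn k)) ks] := expr_vanishing t (ltW gV1) gV_lt1 s0.
  set q := _ * t in ks; have q0 : 0 < q by rewrite mulr_gt0 // exprn_gt0.
  have Fq : F (q *: ei).
    have -> : q *: ei = act (g^-1 ^+ k) (t *: ei) by rewrite act_ei rmorphXn fmorphV.
    by apply: oF.(orbit_closed_act) => //; apply/congruence_unitX/congruence_unitV.
  apply: clF => e e0.
  have [h Gh /andP[h1 he]] :=
    congruence_unit_near1 det_neq0 b_basis i d2 n0 (divr_gt0 e0 s0).
  have [m /andP[ms sm]] := expr_floor h1 q0 (ltW ks).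
  exists ((sigma i (h ^+ m) * q) *: ei).
    by rewrite -act_ei; apply: oF.(orbit_closed_act) => //; apply: congruence_unitX.
  rewrite -scalerBl; apply: le_lt_trans (ei_norm _) _.
  rewrite rmorphXn /= [_ * q]mulrC ger0_norm ?subr_ge0 //.
  rewrite exprSr mulrA in sm; set r := q * _ in ms sm *.
  apply: lt_le_trans (_ : r * (sigma i h - 1) <= e); first by rewrite mulrBr mulr1 ltrBDl subrKC.
  apply: le_trans (_ : s * (sigma i h - 1) <= e).
    by rewrite ler_pM2r // subr_gt0.
  by rewrite mulrC -ler_pdivlMr // lerBlDl ltW.
have Faxis s : F (s *: ei).
  have [s0|s0|->] := ltgtP s 0; last 1 first.
  - apply: clF => e e0; exists ((e / 2) *: ei); first by apply: Fpos; rewrite divr_gt0.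
    rewrite scale0r sub0r normrN; apply: le_lt_trans (ei_norm _) _.
    by rewrite gtr0_norm; lra.
  - by rewrite -[s]opprK scaleNr; apply/FN/Fpos; rewrite oppr_gt0.
  - exact: Fpos.
have [B B0 BP] := zspan_cover det_neq0.
apply/seteqP; split => // p _; apply: clF => e e0.
(* Pull [p] back by [g ^+ k], reduce modulo L to a bounded [r], and push forward: the coordinates of
   [r] other than the [i]-th become smaller than [e], so [p] is close to a lattice translate of the
   axis. *)
have [k kP] : exists k, forall j, j != i -> sigma j g ^+ k * B < e.
  apply: finite_common_bound => j; have [->|ji] := eqVneq j i; first by exists 0%N.
  by have [k kP] := expr_vanishing B (ltW (g0 j)) (gj _ ji) e0; exists k => m /kP.
have Ggk := congruence_unitX k Gg; have gk0 := congruence_unit_neq0 Ggk.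
have [x Lx xB] := BP (act (g ^+ k)^-1 p).
move: xB; set r := act _ p - f x => rB.
have pE : p = act (g ^+ k) r + f (g ^+ k * x).
  by rewrite /r actB actVK // act_phi subrK.
clearbody r.
exists ((sigma i (g ^+ k) * r 0 i) *: ei + f (g ^+ k * x)).
  apply: oF.(orbit_closed_add); last exact: Faxis.
  by case: Ggk => -[_ _ + _] _; apply.
rewrite {1}pE opprD addrACA subrr addr0; apply: row_norm_lt => // j.
rewrite !mxE eqxx /=; have [->|ji] := eqVneq j i; first by rewrite mulr1 subrr normr0.
rewrite mulr0 subr0 normrM rmorphXn /= gtr0_norm ?exprn_gt0 //.
apply: le_lt_trans (kP _ ji); rewrite ler_wpM2l ?exprn_ge0 ?ltW //.
exact: le_lt_trans (coord_le_norm r j) rB.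
Qed.

Definition torsion_row p := exists2 n, (0 < n)%N & exists2 x, L x & p *+ n = f x.

Lemma phi_torsion x : torsion_row (f x).
Proof.
have [n n0 /(_ n (dvdnn n)) nP] := zspan_torsion b_basis x.
by exists n => //; exists (x *+ n) => //; rewrite phiMn.
Qed.

(** Among the points [act (g ^+ k) w], reduced modulo L into a ball, two are close. If they were
    equal, [act (g ^+ k - g ^+ l) w] would lie in [f L], so [w] would be in the image of K, hence
    torsion. *)
Lemma exists_small_difference n F : (1 < d)%N -> (0 < n)%N -> orbit_closed n F ->
  F !=set0 -> (forall p, F p -> ~ torsion_row p) ->
  forall e, 0 < e -> exists p q, [/\ F p, F q, p - q != 0 & `|p - q| < e].
Proof.
move=> d1 n0 oF [w Fw] nt e e0.
have [B _ BP] := zspan_cover det_neq0; pose i := Ordinal d1.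
have [g Gg [_ gi _]] := exists_dominant_congruence_unit det_neq0 b_basis i d1 n0.
have /choice [x xP] k : exists x, L x /\ `|act (g ^+ k) w - f x| < B.
  by have [x] := BP (act (g ^+ k) w); exists x.
pose s k := act (g ^+ k) w - f (x k).
have Fs k : F (s k).
  apply: orbit_closed_sub (xP k).1 _; first exact: oF.
  by apply: oF.(orbit_closed_act) => //; apply: congruence_unitX.
have [k [l [kl klP]]] := bounded_seq_close_pair (fun k => (xP k).2) e0.
exists (s k), (s l); split => //; apply/eqP => /eqP; rewrite subr_eq0 => /eqP skl.
pose v := g ^+ k - g ^+ l.
have v0 : v != 0.
  rewrite -(fmorph_eq0 (sigma i)) rmorphB !rmorphXn subr_eq0 /=.
  by rewrite lt_eqF // ltr_eXn2l.
have vw : act v w = f (x k - x l).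
  rewrite actBl phiD phiN -(subrK (f (x k)) (act (g ^+ k) w)) -/(s k) skl /s.
  by rewrite addrC -[_ + f (x k)]addrA addKr addrC.
apply: (nt w Fw); suff -> : w = f (v^-1 * (x k - x l)) by apply: phi_torsion.
by rewrite -act_phi -vw actKV.
Qed.

(** The set of differences is closed, invariant and symmetric, and 0 is not isolated in it, so
    [orbit_closed_full] applies. *)
Lemma differences_full n F : (2 < d)%N -> (0 < n)%N -> orbit_closed n F ->
  F !=set0 -> (forall p, F p -> ~ torsion_row p) ->
  forall p, exists2 q, F q & F (q - p).
Proof.
move=> d2 n0 oF F0 nt p.
have [B _ BP] := zspan_cover det_neq0.
have clF := (closed_rowP F).1 oF.(orbit_closed_closed).
pose D := [set p | exists2 q, F q & F (q - p)].
suff DT : D = setT by have : D p by rewrite DT.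
apply: (@orbit_closed_full n) => //.
- split.
  + apply/closed_rowP => {}p pD.
    (* Both terms of a difference can be moved by the same lattice vector, so the first may be taken
       bounded and has a cluster point. *)
    pose P (e : R) := [set q | [/\ F q, `|q| <= B &
      exists2 r, F r & `|p - (q - r)| < e]].
    have [|||q qP] := @shrinking_cluster R d P B.
    * move=> e e' e0 ee' q [Fq qB [r Fr h]]; split => //; exists r => //.
      exact: lt_le_trans h ee'.
    * move=> e /pD [r [q Fq Fqr] pr]; have [x Lx xB] := BP q.
      exists (q - f x); split; [exact: orbit_closed_sub oF _ _|exact: ltW|].
      exists (q - r - f x); first exact: orbit_closed_sub oF _ _.
      have -> : q - f x - (q - r - f x) = r by rewrite opprB addrA subrK subKr.
      by [].
    * by move=> e q e0 [].
    exists q; first by apply: clF => e /qP [r [Fr _ _]]; exists r.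
    apply: clF => e e0; have [|r [Fr _ [r' Fr' h]] qr] := qP (e / 2).
      by rewrite divr_gt0.
    exists r' => //.
    have -> : q - p - r' = (q - r) - (p - (r - r')).
      by rewrite opprB -[r - r' - p]addrA subrKA -addrA [- p - r']addrC.
    apply: le_lt_trans (ler_normB _ _) _; lra.
  + move=> u q Gu [r Fr Frq]; exists (act u r); first exact: oF.(orbit_closed_act).
    by rewrite -actB; apply: oF.(orbit_closed_act).
  + move=> x q Lx [r Fr Frq]; exists r => //; rewrite opprD addrA.
    exact: orbit_closed_sub oF _ _.
- move=> q [r Fr Frq]; exists (r - q) => //.
  by rewrite opprK subrK.
- move=> e /(exists_small_difference (ltnW d2) n0 oF F0 nt) [q [r [Fq Fr qr0 qr]]].
  by exists (q - r); split => //; exists q => //; rewrite subKr.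
Qed.

(* Furstenberg's argument: if [M] is minimal then [M] and its translates by
   [1/n]-division points of [L], which meet by [differences_full], coincide. *)
Lemma exists_torsion_row F : (2 < d)%N -> orbit_closed 1 F -> F !=set0 ->
  exists2 p, F p & torsion_row p.
Proof.
move=> d2 oF F0; apply: contrapT => nex.
have nt p : F p -> ~ torsion_row p by move=> Fp tp; apply: nex; exists p.
have clF := (closed_rowP F).1 oF.(orbit_closed_closed).
have coset n : (0 < n)%N -> exists p, forall x, L x -> F (p - n%:R^-1 *: f x).
  move=> n0; have oFn : orbit_closed n F.
    split; [exact: oF.(orbit_closed_closed)| |exact: oF.(orbit_closed_add)].
    by move=> u w [Uu _]; apply: oF.(orbit_closed_act); apply: congruence_unit_one.
  have [M [sM oM M0 minM]] := orbit_closed_minimal oFn F0.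
  have [p Mp] := M0; exists p => x Lx; set r := n%:R^-1 *: f x.
  apply: (sM); pose M' := [set q | M q /\ M (q - r)].
  suff : M `<=` M' by move=> /(_ p Mp) [].
  apply: minM.
  - split.
    + have clM := (closed_rowP M).1 oM.(orbit_closed_closed).
      apply/closed_rowP => q qM'; split; first by apply: clM => e /qM' [s []]; exists s.
      apply: clM => e /qM' [s [_ Ms] qs]; exists (s - r) => //.
      by rewrite opprB addrA subrK.
    + move=> u q Gu [Mq Mqr]; split; first exact: oM.(orbit_closed_act).
      (* As [u] is congruent to 1 modulo [n], it moves [r] by a lattice vector:
         [act u r = r + f y]. *)
      have [y Ly yE] := Gu.2 x Lx.
      have -> : act u q - r = act u (q - r) + f y.
        rewrite actB /r actZ act_phi -addrA; congr (_ + _).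
        have -> : u * x = x + y *+ n by rewrite -yE; ring.
        rewrite phiD phiMn scalerDr -scalerMnr scalerMnl -[_^-1 *+ n]mulr_natr.
        rewrite mulVf ?pnatr_eq0 -?lt0n //.
        by rewrite scale1r opprD subrK.
      by apply: oM.(orbit_closed_add) => //; apply: oM.(orbit_closed_act).
    + move=> y q Ly [Mq Mqr]; split; first exact: oM.(orbit_closed_add).
      by rewrite addrAC; apply: oM.(orbit_closed_add).
  - have [|q Mq Mqr] := differences_full d2 n0 oM M0 _ r; first by move=> q /sM/nt.
    by exists q.
  - by move=> q [].
have [B B0 BP] := zspan_cover det_neq0.
suff F00 : F 0.
  apply: (nt 0 F00); exists 1%N => //; exists 0; first exact: zspan0.
  by apply/rowP => i; rewrite !mxE rmorph0.
(* With [B / n < e], every translate of L / n has a point within [e] of 0. *)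
apply: clF => e e0; pose n := (Num.bound (B / e)).+1.
have n0 : 0 < n%:R :> R by rewrite ltr0n.
have [//|p pP] := coset n; have [x Lx xB] := BP (n%:R *: p).
exists (p - n%:R^-1 *: f x); first exact: pP.
have -> : 0 - (p - n%:R^-1 *: f x) = - (n%:R^-1 *: (n%:R *: p - f x)).
  by rewrite sub0r scalerBr scalerA mulVf ?scale1r // lt0r_neq0.
rewrite normrN normrZ gtr0_norm ?invr_gt0 // ltr_pdivrMl //.
apply: lt_trans xB _; rewrite -ltr_pdivrMr //.
apply: lt_le_trans (archi_boundP _) _; last by rewrite ler_nat.
by rewrite divr_ge0 // ltW.
Qed.

(* The orbit closure of [v] contains a torsion point [p]; if [p *+ n] is in [f L],
   the grid [f L + v *+ n] has, up to units, points arbitrarily close to 0. *)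
Lemma small_norm_multiple (v : 'rV[R]_d) : (2 < d)%N -> exists2 n, (0 < n)%N &
  forall e, 0 < e -> exists2 x, L x & `|normN (f x + v *+ n)| < e.
Proof.
move=> d2; pose O := [set w | exists u x, [/\ G 1 u, L x & w = act u v + f x]].
have [||p Op [n n0 [y Ly pn]]] := @exists_torsion_row (closure O) d2.
- split; first exact: closed_closure.
  + move=> u w Gu /closure_rowP Ow; apply/closure_rowP => e e0.
    have [C C0 CP] := act_bounded sigma u.
    have [|q [u' [x [Gu' Lx ->]]] wq] := Ow (e / C); first by rewrite divr_gt0.
    exists (act u (act u' v + f x)).
      exists (u * u'), (u * x); split; first exact: congruence_unitM.
        by case: Gu => -[_ _ + _] _; apply.
      by rewrite actD act_phi actM.
    by rewrite -actB; apply: le_lt_trans (CP _) _; rewrite mulrC -ltr_pdivlMr.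
  + move=> x w Lx /closure_rowP Ow; apply/closure_rowP => e /Ow [_ [u [y [Gu Ly ->]]] h].
    exists (act u v + f y + f x); last by rewrite opprD addrACA subrr addr0.
    by exists u, (y + x); split => //; [apply: zspanD|rewrite phiD addrA].
- exists v; apply: subset_closure; exists 1, 0; split; first exact: congruence_unit1.
    exact: zspan0.
  by apply/rowP => i; rewrite !mxE rmorph0 rmorph1 mul1r addr0.
exists n => // e e0.
(* A sup norm below [c] bounds one factor of the norm by [e] and the others by 1. *)
pose c := Num.min (e / 2) 1; have c0 : 0 < c by rewrite lt_min divr_gt0 // ltr01.
move/closure_rowP: Op => /(_ (c / n%:R)) [|_ [u [x [Gu Lx ->]]] h].
  by rewrite divr_gt0 // ltr0n.
have [[u0 nu su sV] _] := Gu.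
(* Multiplying the approximation of [p] by [n] puts [act u (v *+ n) + f (x *+ n - y)] close to 0;
   the witness is pulled back by [u]. *)
exists (u^-1 * (x *+ n - y)); first by apply: sV; apply: zspanB => //; apply: zspanMn.
set w := f _ + _; have small : `|act u w| < c.
  have -> : act u w = - ((p - (act u v + f x)) *+ n).
    rewrite /w actD act_phi mulVKf // phiD phiN phiMn actMn -pn -[RHS]mulNrn opprB.
    by rewrite -mulrnBl -mulrnDl addrC addrA.
  by rewrite normrN normrMn -[_ *+ n]mulr_natr -ltr_pdivlMr // ltr0n.
have -> : `|normN w| = `|normN (act u w)|.
  by rewrite normN_act normrM nu mul1r.
rewrite /normN normr_prod; have d0 : (0 < d)%N by apply: leq_trans d2.
rewrite (bigD1 (Ordinal d0)) //=.
have coord i : `|act u w ord0 i| < c := le_lt_trans (coord_le_norm _ i) small.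
apply: le_lt_trans (_ : `|act u w ord0 (Ordinal d0)| < e).
  rewrite ler_piMr // prodr_ile1 // => i _; rewrite normr_ge0 /=.
  by have := coord i; rewrite lt_min => /andP[_ /ltW].
by have := coord (Ordinal d0); rewrite lt_min => /andP[]; lra.
Qed.
End Orbits.

(** * From small norms to a vanishing infimum *)

Lemma inf_eq0 (R : realType) (A : set R) : (forall a, A a -> 0 <= a) ->
  (forall e, 0 < e -> exists2 a, A a & a < e) -> inf A = 0.
Proof.
move=> A_ge0 A_small; have lbA : has_lbound A by exists 0 => a; apply: A_ge0.
apply/eqP; rewrite eq_le; apply/andP; split; last first.
  by apply: lb_le_inf; [have [a Aa _] := A_small 1 ltr01; exists a|move=> a; apply: A_ge0].
rewrite leNgt; apply/negP => /A_small [a /(ge_inf lbA)].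
by rewrite leNgt => /negP.
Qed.

Theorem theorem4p9 (R : realType) (d : nat) (K : fieldExtType rat)
  (sigma : 'I_d -> {rmorphism K -> R}) (b : d.-tuple K) (c : R) :
  (3 <= d)%N ->
  \dim {:K} = d ->
  (* sigma_1, ..., sigma_d are d pairwise distinct real embeddings: K is totally real *)
  (forall i j : 'I_d, (forall x : K, sigma i x = sigma j x) -> i = j) ->
  (* Lambda = Z-span of the Q-basis b of K *)
  basis_of {:K} b ->
  (* c > 0 normalizes the covolume of c phi(Lambda) to one *)
  0 < c -> c ^+ d * `|\det (embmx sigma b)| = 1 ->
  GFL (xLambda sigma b c).
Proof.
move=> d2 _ _ b_basis c0 covol v.
have det_neq0 : \det (embmx sigma b) != 0.
  by apply: contra_eq_neq covol => ->; rewrite normr0 mulr0 eq_sym oner_eq0.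
(* The unscaled lattice is used with [c^-1 *: v]; scaling back by [c] multiplies the norm by
   [c ^+ d], whence the bound [e / c ^+ d] below. *)
have [n n0 nP] := small_norm_multiple det_neq0 b_basis (c^-1 *: v) d2.
exists n%:Z; split; first by rewrite -lt0n.
apply: inf_eq0 => [_ [w _ <-]|e e0]; first exact: normr_ge0.
have cd0 : 0 < c ^+ d by rewrite exprn_gt0.
have [|x Lx small] := nP (e / c ^+ d); first by rewrite divr_gt0.
exists `|normN (c *: phi sigma x + v *~ n%:Z)|.
  by exists (c *: phi sigma x + v *~ n%:Z) => //; exists (c *: phi sigma x) => //; exists x.
have -> : c *: phi sigma x + v *~ n%:Z = c *: (phi sigma x + (c^-1 *: v) *+ n).
  by rewrite -pmulrn scalerDr -scalerMnr scalerA divff ?lt0r_neq0 // scale1r.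
set w := _ + _ in small *.
have -> : normN (c *: w) = c ^+ d * normN w.
  have -> : c ^+ d = \prod_(i < d) c by rewrite prodr_const card_ord.
  by rewrite /normN -big_split; apply: eq_bigr => i _; rewrite mxE.
by rewrite normrM gtr0_norm // mulrC -ltr_pdivlMr.
Qed.
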